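(* If $\Gamma$ is a graph arising as a regular tiling of the hyperbolic plane, then $\mathsf{sCop}(\Gamma)=1$.
   Context: Graphs are undirected, without double edges and without loops. A graph arising as a regular tiling of the hyperbolic plane is the graph of vertices and edges of a tiling of the hyperbolic plane by congruent regular (compact) $p$-gons with $q$ of them meeting at each vertex (for integers $p,q\ge3$ with $\frac1p+\frac1q<\frac12$). For a connected graph $\Gamma$, $\mathsf{dist}$ is the path distance on $V(\Gamma)$. Game. The cops and robber game on a connected graph $\Gamma$ has parameters: number of cops $n$, cop speed $\sigma$, cop reach $\rho$, robber speed $\psi$, a vertex $v$, and a positive integer $R$. It is a perfect information game. First the $n$ cops choose initial vertices $c^1_0,\dots,c^n_0$; then, knowing these, the robber chooses an initial vertex $r_0$. In stage $k\ge 1$ each cop moves from $c^i_{k-1}$ to a vertex $c^i_k$ with $\mathsf{dist}(c^i_{k-1},c^i_k)\le\sigma$. The robber is captured during stage $k$ if $\mathsf{dist}(r_{k-1},c^i_k)\le\rho$ for some $i$. If not captured, the robber moves from $r_{k-1}$ to a vertex $r_k$ such that there is a path from $r_{k-1}$ to $r_k$ of length at most $\psi$ all of whose vertices are at distance larger than $\rho$ from every $c^i_k$. The cops win (protect the $R$-ball centered at $v$) if the robber is captured at some stage or there is $N>0$ such that $\mathsf{dist}(v,r_k)>R$ for all $k\ge N$. $\Gamma$ is $\mathsf{CopWin}(n,\sigma,\rho,\psi,R)$ if for every vertex $v$ of $\Gamma$ the $n$ cops have a winning strategy in the game with parameters $n,\sigma,\rho,\psi,v,R$. $\Gamma$ is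 $n$-strong cop win if $\exists\,\sigma\in\mathbb{Z}_{>0}\ \forall\,\psi\in\mathbb{Z}_{>0}\ \exists\,\rho\in\mathbb{Z}_{\ge0}\ \forall\,R\in\mathbb{Z}_{>0}$: $\Gamma$ is $\mathsf{CopWin}(n,\sigma,\rho,\psi,R)$. The strong cop number $\mathsf{sCop}(\Gamma)\in\mathbb{Z}_{>0}\cup\{\infty\}$ is the smallest positive integer $n$ such that $\Gamma$ is $n$-strong cop win, and $\infty$ if there is none. *)

(* Defs.v *)
From HB Require Import structures.
From mathcomp Require Import all_boot all_order all_algebra.
From mathcomp Require Import all_classical all_reals all_analysis.
Set Implicit Arguments.
Unset Strict Implicit.
Unset Printing Implicit Defensive.
Import Order.TTheory GRing.Theory Num.Theory.
Local Open Scope classical_set_scope.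
Local Open Scope ring_scope.

Record sgraph := SGraph {
  vertex :> Type;
  adj : vertex -> vertex -> Prop;
  adj_sym : forall x y, adj x y -> adj y x;
  adj_irrefl : forall x, ~ adj x x }.

Definition sgraph_iso (G H : sgraph) : Prop :=
  exists f : G -> H,
    bijective f /\ forall x y, adj x y <-> adj (f x) (f y).

(* The vertices of the walk are [w 0], ..., [w l]; later values of [w] are
   irrelevant. *)
Definition walk (G : sgraph) (x y : G) (l : nat) (w : nat -> G) : Prop :=
  [/\ w 0%N = x, w l = y & forall i, (i < l)%N -> adj (w i) (w i.+1)].

(* [dist_le x y m] is dist(x, y) <= m, i.e. the shortest walk between x and y
   has length at most m; dist(x, y) > m is its negation.  In this form
   vertices in different components are at distance infinity. *)
Definition dist_le (G : sgraph) (x y : G) (m : nat) : Prop :=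
  exists l w, (l <= m)%N /\ walk x y l w.

(* A strategy maps the robber's past positions [:: r_0; ...; r_(k-1)] to the
   cops' positions c_k of stage k; in particular [S [::]] is the choice of the
   initial positions.  The past positions of the cops are determined by the
   strategy and need not be recorded in the history. *)
Definition strategy (G : sgraph) (n : nat) := seq G -> 'I_n -> G.

Definition legal_strategy (G : sgraph) (n sigma : nat) (S : strategy G n) :
    Prop :=
  forall (h : seq G) (x : G) (i : 'I_n), dist_le (S h i) (S (rcons h x) i) sigma.

Section Play.
Variables (G : sgraph) (n rho psi : nat) (S : strategy G n) (r : nat -> G).

Definition cops (k : nat) : 'I_n -> G := S (mkseq r k).

(* Stages are numbered from 1: stage k.+1 starts from the positions of index k. *)
Definition captured (k : nat) : Prop :=
  exists i : 'I_n, dist_le (r k) (cops k.+1 i) rho.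

Definition robber_move (k : nat) : Prop :=
  exists l w, [/\ (l <= psi)%N, walk (r k) (r k.+1) l w &
    forall j, (j <= l)%N -> forall i : 'I_n, ~ dist_le (w j) (cops k.+1 i) rho].

(* The play stops at the first capture: from then on the values of [r] are
   unconstrained and have no meaning. *)
Definition robber_play : Prop :=
  forall k, (forall j, (j <= k)%N -> ~ captured j) -> robber_move k.

Definition cops_win (v : G) (rad : nat) : Prop :=
  (exists k, captured k) \/
  (exists N, (0 < N)%N /\ forall k, (N <= k)%N -> ~ dist_le v (r k) rad).

End Play.

Definition CopWin (G : sgraph) (n sigma rho psi rad : nat) : Prop :=
  forall v : G, exists S : strategy G n,
    legal_strategy sigma S /\
    forall r : nat -> G, robber_play rho psi S r -> cops_win rho S r v rad.

Definition strong_cop_win (G : sgraph) (n : nat) : Prop :=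
  exists sigma, (0 < sigma)%N /\
  forall psi, (0 < psi)%N ->
  exists rho : nat,
  forall rad, (0 < rad)%N -> CopWin G n sigma rho psi rad.

(* [None] stands for infinity. *)
Definition sCop (G : sgraph) : option nat :=
  match pselect (exists n, `[< (0 < n)%N /\ strong_cop_win G n >]) with
  | left ex => Some (ex_minn ex)
  | right _ => None
  end.

Section Hyperbolic.
Variable R : realType.
Local Notation pt := 'rV[R]_3.

Definition lorentz (x y : pt) : R :=
  - (x 0 0 * y 0 0) + x 0 1 * y 0 1 + x 0 2%:R * y 0 2%:R.

Definition H2 : set pt := [set x | lorentz x x = -1 /\ 0 < x 0 0].

Definition arcosh (t : R) : R := ln (t + Num.sqrt (t ^+ 2 - 1)).

Definition hdist (x y : pt) : R := arcosh (- lorentz x y).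

Definition H2_isometry (g : pt -> pt) : Prop :=
  g @` H2 = H2 /\ {in H2 &, forall x y, hdist (g x) (g y) = hdist x y}.

(* Tangent vector at x of the geodesic towards y: the projection of y on the
   tangent plane of H2 at x, on which the Lorentz form is positive definite. *)
Definition tangent (x y : pt) : pt := y + lorentz x y *: x.

(* The angle at x between the geodesics from x to y and from x to z. *)
Definition hangle (y x z : pt) : R :=
  let u := tangent x y in let w := tangent x z in
  acos (lorentz u w / (Num.sqrt (lorentz u u) * Num.sqrt (lorentz w w))).

(* Geodesics are the intersections of H2 with linear planes, so the convex hull
   of a finite set of points is the trace on H2 of the cone they span. *)
Definition hhull (n : nat) (v : 'I_n -> pt) : set pt :=
  [set x | H2 x /\
    exists a : 'I_n -> R, (forall i, 0 <= a i) /\ x = \sum_i a i *: v i].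

Definition hsegment (x y : pt) : set pt :=
  [set z | H2 z /\ exists a b : R, [/\ 0 <= a, 0 <= b & z = a *: x + b *: y]].

(* The sign of [side x y z] tells on which side of the geodesic line through x
   and y the point z lies; it vanishes when z is on the line. *)
Definition side (x y z : pt) : R := \det (col_mx x (col_mx y z) : 'M[R]_3).

(* v lists in cyclic order the vertices of a convex polygon: the line through
   two consecutive vertices has all other vertices strictly on one side. *)
Definition convex_polygon (p : nat) (v : 'I_p -> pt) : Prop :=
  [/\ forall i, H2 (v i),
      forall i, v i <> v (ordS i) &
      forall i j k, j \notin [:: i; ordS i] -> k \notin [:: i; ordS i] ->
        0 < side (v i) (v (ordS i)) (v j) * side (v i) (v (ordS i)) (v k)].

Definition regular_polygon (p : nat) (v : 'I_p -> pt) : Prop :=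
  [/\ convex_polygon v,
      forall i j, hdist (v i) (v (ordS i)) = hdist (v j) (v (ordS j)) &
      forall i j, hangle (v (ord_pred i)) (v i) (v (ordS i)) =
                  hangle (v (ord_pred j)) (v j) (v (ordS j))].

(* A tiling is given by a family of tiles, each by its vertices in cyclic
   order. *)
Section Tiling.
Variables (p : nat) (I : Type) (P : I -> 'I_p -> pt).

Definition tile (i : I) : set pt := hhull (P i).

Definition tile_edge (i : I) (k : 'I_p) : set pt :=
  hsegment (P i k) (P i (ordS k)).

Definition congruent_tiles : Prop :=
  forall i j, exists g, H2_isometry g /\ g @` tile i = tile j.

(* Two different tiles are disjoint or meet exactly in a common vertex or in a
   common edge; in particular their interiors are disjoint. *)
Definition edge_to_edge : Prop :=
  forall i j, i <> j ->
    [\/ tile i `&` tile j = set0,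
        exists k l, P i k = P j l /\ tile i `&` tile j = [set P i k] |
        exists k l, tile_edge i k = tile_edge j l /\
                    tile i `&` tile j = tile_edge i k].

Definition tiling_vertex (x : pt) : Prop := exists i k, x = P i k.

Definition regular_tiling (q : nat) : Prop :=
  [/\ forall i, regular_polygon (P i),
      congruent_tiles,
      \bigcup_i tile i = H2,
      edge_to_edge &
      forall x, tiling_vertex x ->
        ([set i | exists k, x = P i k] #= `I_q)%card].

Definition tiling_adj (x y : {x : pt | tiling_vertex x}) : Prop :=
  sval x <> sval y /\
  exists i k, (sval x = P i k /\ sval y = P i (ordS k)) \/
              (sval y = P i k /\ sval x = P i (ordS k)).

Lemma tiling_adj_sym x y : tiling_adj x y -> tiling_adj y x.
Proof.
by case=> ne [i [k xy]]; split; [exact: nesym | exists i, k; apply/or_comm].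
Qed.

Lemma tiling_adj_irrefl x : ~ tiling_adj x x.
Proof. by case. Qed.

Definition tiling_graph : sgraph := SGraph tiling_adj_sym tiling_adj_irrefl.

End Tiling.

Definition hyperbolic_tiling_graph (G : sgraph) : Prop :=
  exists (p q : nat) (I : Type) (P : I -> 'I_p -> pt),
    [/\ (3 <= p)%N, (3 <= q)%N, p%:R^-1 + q%:R^-1 < 2^-1 :> R,
        regular_tiling P q & sgraph_iso (tiling_graph P) G].

End Hyperbolic.

(* Main.v *)
Require Import Defs.
From mathcomp Require Import all_boot all_order all_algebra.
From mathcomp Require Import all_classical all_reals all_analysis.
From mathcomp Require Import ring lra.
Set Implicit Arguments.
Unset Strict Implicit.
Unset Printing Implicit Defensive.
Import Order.TTheory GRing.Theory Num.Theory numFieldNormedType.Exports.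
Local Open Scope classical_set_scope.
Local Open Scope ring_scope.

(** A single cop can protect balls in any graph that is coarsely the hyperbolic
plane, because in that plane two long geodesic rays from a point, ending at
points a bounded distance apart, stay together until shortly before their
ends.  The cop starts at the centre v of the ball and, at stage k, steps to
a vertex near the point at distance k log 2 from v on the geodesic from v to
the current position of the robber.  A move of the robber bends this geodesic
only near its far end, so as long as the robber stays farther from v than the
cop by a margin depending on the robber's speed psi, the cop travels a distance
that does not depend on psi ([geo_thin]).  This is what lets the cop speed be
fixed before psi.  If the margin is ever lost, the robber is at a bounded
distance from the cop, and a reach chosen after psi catches it.  If it is never
lost, the distance from v to the robber grows without bound.  Since this choice
of reach does not involve the radius of the protected ball, one cop wins
([coarse_model_strong_cop_win]).

Distances are handled through [chd x y], the negated Lorentz product, which is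
the hyperbolic cosine of the distance.  The triangle inequality is the
nonpositivity of a Gram determinant, equal to minus the square of a 3 x 3
determinant ([gram_det3]); it is mostly used in the crude multiplicative form
[chd_triangle].

It remains to see that graph distance between vertices of the tiling is bounded
in terms of hyperbolic distance ([tiling_coarse]).  The tiles are images of one
tile under isometries, hence have a common diameter and contain balls of
a common radius.  Two such balls with close centres would force an intersection
of two tiles to contain a ball, whereas it lies in a plane section of the
hyperboloid; so the centres are uniformly separated, and a ball of given radius
meets boundedly many tiles ([tiles_locally_finite]).  The segment between two
vertices is covered by such a bounded family of closed tiles and is connected,
so its ends are joined by a bounded chain of touching tiles ([tile_chain]).
Touching tiles share a vertex, and the corners of one tile are joined along
its boundary. *)

(** * Lorentz geometry of the hyperboloid *)

Section LorentzGeometry.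
Variable R : realType.
Local Notation pt := 'rV[R]_3.
Local Notation H2 := (@H2 R).
Implicit Types (a b c n u v w x y z : pt) (s t r e : R).

Lemma pt_eqP x y :
  x 0 0 = y 0 0 -> x 0 1 = y 0 1 -> x 0 2%:R = y 0 2%:R -> x = y.
Proof.
move=> h0 h1 h2; apply/rowP; case=> [[|[|[|//]]] hi].
- by have -> : Ordinal hi = 0 by exact: val_inj.
- by have -> : Ordinal hi = 1 by exact: val_inj.
- by have -> : Ordinal hi = 2%:R by exact: val_inj.
Qed.

Lemma lorentzC x y : lorentz x y = lorentz y x.
Proof. rewrite /lorentz; ring. Qed.

Lemma lorentzDl x y z : lorentz (x + y) z = lorentz x z + lorentz y z.
Proof. rewrite /lorentz !mxE; ring. Qed.

Lemma lorentzZl s x z : lorentz (s *: x) z = s * lorentz x z.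
Proof. rewrite /lorentz !mxE; ring. Qed.

Lemma lorentzNl x z : lorentz (- x) z = - lorentz x z.
Proof. rewrite /lorentz !mxE; ring. Qed.

Lemma lorentz0l z : lorentz 0 z = 0.
Proof. rewrite /lorentz !mxE; ring. Qed.

Lemma lorentzDr x y z : lorentz z (x + y) = lorentz z x + lorentz z y.
Proof. by rewrite lorentzC lorentzDl !(lorentzC _ z). Qed.

Lemma lorentzZr s x z : lorentz z (s *: x) = s * lorentz z x.
Proof. by rewrite lorentzC lorentzZl lorentzC. Qed.

Lemma lorentzNr x z : lorentz z (- x) = - lorentz z x.
Proof. by rewrite lorentzC lorentzNl lorentzC. Qed.

Definition lorentzE := (lorentzDl, lorentzDr, lorentzZl, lorentzZr,
  lorentzNl, lorentzNr).

Lemma lorentz_suml m (F : 'I_m -> pt) z :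
  lorentz (\sum_i F i) z = \sum_i lorentz (F i) z.
Proof.
by apply: (big_morph (fun x => lorentz x z)) => [x y|];
  rewrite (lorentzDl, lorentz0l).
Qed.

Lemma lorentz_sumr m (F : 'I_m -> pt) z :
  lorentz z (\sum_i F i) = \sum_i lorentz z (F i).
Proof.
by rewrite lorentzC lorentz_suml; apply: eq_bigr => i _; rewrite lorentzC.
Qed.

(** The expanded form lets [ring] prove the identities below. *)
Definition det3 x y z : R :=
  x 0 0 * (y 0 1 * z 0 2%:R - y 0 2%:R * z 0 1)
  - x 0 1 * (y 0 0 * z 0 2%:R - y 0 2%:R * z 0 0)
  + x 0 2%:R * (y 0 0 * z 0 1 - y 0 1 * z 0 0).

Lemma side_det3 x y z : side x y z = det3 x y z.
Proof.
pose A : 'M[R]_3 := col_mx x (col_mx y z); rewrite /side -/A.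
pose f (w : pt) k := nth 0 [:: w 0 0; w 0 1; w 0 2%:R] k.
have fE w (j : 'I_3) : w 0 j = f w j.
  by rewrite /f; case: j => [[|[|[|//]]] hj] /=; congr (w 0 _); apply: val_inj.
have AE i j : A i j = f (nth 0 [:: x; y; z] i) j.
  rewrite -fE; case: (split_ordP (i : 'I_(1 + (1 + 1)))) => k ->.
    by apply: etrans (col_mxEu x (col_mx y z) k j) _; rewrite ord1.
  apply: etrans (col_mxEd x (col_mx y z) k j) _.
  case: (split_ordP k) => l ->; rewrite ord1.
    by rewrite col_mxEu.
  by rewrite col_mxEd.
move: A AE => A AE.
rewrite (expand_det_row _ ord0) !big_ord_recl big_ord0 /cofactor.
rewrite !(expand_det_row _ ord0) !big_ord_recl !big_ord0 /cofactor.
rewrite !det_mx11 !mxE !AE /f /det3 /= /bump /= ?addn0 ?add0n ?expr0 ?expr1.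
by ring.
Qed.

Lemma cramer3 a b c z :
  det3 a b c *: z = det3 z b c *: a + det3 a z c *: b + det3 a b z *: c.
Proof. by apply: pt_eqP; rewrite /det3 !mxE; ring. Qed.

(** The Gram matrix of c, n, z is A J A^T with A the matrix of their
coordinates and J the diagonal matrix (-1, 1, 1). *)
Lemma gram_det3 c n z :
  lorentz c c * (lorentz n n * lorentz z z - lorentz n z ^+ 2)
  - lorentz c n * (lorentz c n * lorentz z z - lorentz n z * lorentz c z)
  + lorentz c z * (lorentz c n * lorentz n z - lorentz n n * lorentz c z)
  = - det3 c n z ^+ 2.
Proof. rewrite /lorentz /det3; ring. Qed.

(** Cauchy-Schwarz for the projections of n and z to the plane orthogonal to
c, on which the Lorentz form is positive definite.  The vector n may be
arbitrary: with n in the hyperboloid this is the triangle inequality, and with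
n the normal of a plane it controls how fast a linear form varies near c. *)
Lemma gram_schwarz c n z : lorentz c c = -1 -> lorentz z z = -1 ->
  (lorentz n z + lorentz n c * lorentz z c) ^+ 2 <=
  (lorentz n n + lorentz n c ^+ 2) * (lorentz z c ^+ 2 - 1).
Proof.
move=> hc hz; have := gram_det3 c n z; rewrite hc hz !(lorentzC c).
have := sqr_ge0 (det3 c n z); lra.
Qed.


(** The hyperbolic cosine of the distance. *)
Definition chd x y : R := - lorentz x y.

Lemma chdC x y : chd x y = chd y x.
Proof. by rewrite /chd lorentzC. Qed.

Lemma chdxx x : H2 x -> chd x x = 1.
Proof. by case=> hx _; rewrite /chd hx opprK. Qed.

Lemma lorentz_chd x y : lorentz x y = - chd x y.
Proof. by rewrite /chd opprK. Qed.

Lemma le_of_sqr s t : 0 <= t -> s ^+ 2 <= t ^+ 2 -> s <= t.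
Proof. by move=> t0 h; rewrite leNgt; apply/negP => ts; nra. Qed.

Lemma H2_time_ge1 x : H2 x -> 1 <= x 0 0.
Proof.
case=> hx x0; apply: le_of_sqr; first exact: ltW.
by move: hx; rewrite /lorentz; have := sqr_ge0 (x 0 1);
  have := sqr_ge0 (x 0 2%:R); rewrite !expr2; lra.
Qed.

(** Reversed Cauchy-Schwarz inequality, from Lagrange's identity. *)
Lemma chd_ge1 x y : H2 x -> H2 y -> 1 <= chd x y.
Proof.
case=> hx x0 [hy y0]; move: hx hy; rewrite /chd /lorentz => hx hy.
set p := x 0 1 * y 0 1 + x 0 2%:R * y 0 2%:R.
have : 1 + p <= x 0 0 * y 0 0; last by rewrite /p; lra.
apply: le_of_sqr; first by rewrite mulr_ge0 // ltW.
have -> : (x 0 0 * y 0 0) ^+ 2 =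
  (1 + x 0 1 ^+ 2 + x 0 2%:R ^+ 2) * (1 + y 0 1 ^+ 2 + y 0 2%:R ^+ 2).
  by rewrite exprMn; congr (_ * _); lra.
rewrite -subr_ge0.
have -> : (1 + x 0 1 ^+ 2 + x 0 2%:R ^+ 2) * (1 + y 0 1 ^+ 2 + y 0 2%:R ^+ 2)
   - (1 + p) ^+ 2 = (x 0 1 - y 0 1) ^+ 2 + (x 0 2%:R - y 0 2%:R) ^+ 2
     + (x 0 1 * y 0 2%:R - x 0 2%:R * y 0 1) ^+ 2 by rewrite /p; ring.
by rewrite !addr_ge0 ?sqr_ge0.
Qed.

(** The other sheet of the hyperboloid consists of the opposites of the points
of [H2], for which [chd x] is negative. *)
Lemma H2_of_chd_gt0 x z : H2 x -> lorentz z z = -1 -> 0 < chd x z -> H2 z.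
Proof.
case=> hx x0 hz hxz; split => //; rewrite ltNge; apply/negP => z0.
have : H2 (- z); last first.
  by move=> /(chd_ge1 (conj hx x0)); rewrite /chd lorentzNr; move: hxz;
    rewrite /chd; lra.
split; first by rewrite lorentzNl lorentzNr opprK.
rewrite mxE oppr_gt0 lt_neqAle z0 andbT; apply/eqP => z00.
by move: hz; rewrite /lorentz z00; have := sqr_ge0 (z 0 1);
  have := sqr_ge0 (z 0 2%:R); rewrite !expr2; lra.
Qed.

(** With a = d(x,y), b = d(y,z), c = d(x,z), this is
|cosh c - cosh a cosh b| <= sinh a sinh b. *)
Lemma chd_gram x y z : H2 x -> H2 y -> H2 z ->
  (chd x z - chd x y * chd y z) ^+ 2 <=
  (chd x y ^+ 2 - 1) * (chd y z ^+ 2 - 1).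
Proof.
move=> [hx _] [hy _] [hz _]; have := gram_schwarz x hy hz.
rewrite hx !lorentz_chd (chdC z y) => h.
apply: le_trans (le_trans h _); rewrite le_eqVlt; apply/orP; left; apply/eqP;
  ring.
Qed.

(** From cosh (a + b) <= 2 cosh a cosh b. *)
Lemma chd_triangle x y z : H2 x -> H2 y -> H2 z ->
  chd x z <= 2 * chd x y * chd y z.
Proof.
move=> hx hy hz; have h := chd_gram hx hy hz.
have a1 := chd_ge1 hx hy; have b1 := chd_ge1 hy hz.
move: h a1 b1; set a := chd x y; set b := chd y z; set c := chd x z => h a1 b1.
have : c - a * b <= a * b; last by lra.
by apply: le_of_sqr; nra.
Qed.

(** The multiplicative form says nothing about small distances; here
cosh (2 a) <= 1 + 6 r when cosh a <= 1 + r <= 2. *)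
Lemma chd_triangle_small x y z r : H2 x -> H2 y -> H2 z -> r <= 1 ->
  chd x y <= 1 + r -> chd y z <= 1 + r -> chd x z <= 1 + 6 * r.
Proof.
move=> hx hy hz r1; have h := chd_gram hx hy hz.
have a1 := chd_ge1 hx hy; have b1 := chd_ge1 hy hz.
move: h a1 b1; set a := chd x y; set b := chd y z; set c := chd x z.
move=> h a1 b1 ar br; have r0 : 0 <= r by lra.
have : c - a * b <= 2 * r + r ^+ 2; last by nra.
apply: le_of_sqr; first by nra.
apply: le_trans h _; rewrite [leRHS]expr2; apply: ler_pM; nra.
Qed.

Lemma chd_chain (x y z : pt) s t : H2 x -> H2 y -> H2 z ->
  chd x y <= s -> chd y z <= t -> chd x z <= 2 * s * t.
Proof.
move=> hx hy hz hs ht; apply: le_trans (chd_triangle hx hy hz) _.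
have a1 := chd_ge1 hx hy; have b1 := chd_ge1 hy hz.
by rewrite -!mulrA ler_pM2l // ler_pM //; lra.
Qed.

Lemma arcosh_inj s t : 1 <= s -> 1 <= t -> arcosh s = arcosh t -> s = t.
Proof.
wlog st : s t / s <= t => [H s1 t1 e|].
  by case/orP: (le_total s t) => h; [exact: H | apply/esym/H].
move=> s1 t1; rewrite /arcosh => /ln_inj.
have pos r : 1 <= r -> r + Num.sqrt (r ^+ 2 - 1) \is Num.pos.
  by move=> r1; rewrite posrE; have := sqrtr_ge0 (r ^+ 2 - 1); lra.
move=> /(_ (pos _ s1) (pos _ t1)) e.
have : Num.sqrt (s ^+ 2 - 1) <= Num.sqrt (t ^+ 2 - 1).
  by rewrite ler_sqrt; nra.
by lra.
Qed.

Lemma isometry_H2 g x : H2_isometry g -> H2 x -> H2 (g x).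
Proof. by case=> gH _ hx; have : H2 (g x) by rewrite -gH; exists x. Qed.

Lemma isometry_chd g x y : H2_isometry g -> H2 x -> H2 y ->
  chd (g x) (g y) = chd x y.
Proof.
move=> hg hx hy; apply: arcosh_inj.
- by apply: chd_ge1; exact: isometry_H2.
- exact: chd_ge1.
- by case: hg => _; apply; rewrite inE.
Qed.

Lemma le_sqrt_chd s t : 0 <= s -> s + 1 <= t ->
  s <= Num.sqrt (t ^+ 2 - 1).
Proof.
by move=> s0 st; apply: le_of_sqr; rewrite ?sqrtr_ge0 // sqr_sqrtr; nra.
Qed.

(** The point at distance ln e from v on the geodesic from v to x, that is
cosh (ln e) v + sinh (ln e) u with u the unit tangent vector at v towards x.
The parameter e turns the unit steps of the cop into doublings. *)
Definition geo v e x : pt :=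
  ((e + e^-1) / 2) *: v +
  ((e - e^-1) / 2 / Num.sqrt (chd v x ^+ 2 - 1)) *: (x - chd v x *: v).

Lemma chd_geol v e x : H2 v -> chd v (geo v e x) = (e + e^-1) / 2.
Proof.
case=> hv _; rewrite /chd /geo !lorentzE hv /chd; ring.
Qed.

Lemma H2_geo v e x : 0 < e -> H2 v -> H2 x -> 1 < chd v x -> H2 (geo v e x).
Proof.
move=> e0 hv hx A1; have ei : e * e^-1 = 1 by rewrite mulfV ?gt_eqF.
have ei0 : 0 < e^-1 by rewrite invr_gt0.
apply: (H2_of_chd_gt0 hv); last by rewrite chd_geol //; lra.
have sq : Num.sqrt (chd v x ^+ 2 - 1) ^+ 2 = chd v x ^+ 2 - 1.
  by rewrite sqr_sqrtr //; nra.
have s0 : 0 < Num.sqrt (chd v x ^+ 2 - 1) by rewrite sqrtr_gt0; nra.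
case: (hv) (hx) => hv1 _ [hx1 _].
rewrite /geo; move: sq s0; set sa := Num.sqrt _ => sq s0.
rewrite !lorentzE hv1 hx1 (lorentzC x v) lorentz_chd.
move: A1 sq; set A := chd v x => A1 sq.
have A2 : A ^+ 2 = sa ^+ 2 + 1 by lra.
transitivity (- ((e + e^-1) / 2) ^+ 2
   + ((e - e^-1) / 2 / sa) ^+ 2 * (A ^+ 2 - 1)); first by ring.
rewrite A2; transitivity (- (e * e^-1)); last by rewrite ei.
by field; lra.
Qed.

(** With e = exp s and cosh a = chd v x, the left side is cosh (a - s). *)
Lemma chd_geo_end v e x : 1 <= e -> H2 v -> H2 x -> 1 < chd v x ->
  chd (geo v e x) x <= e / chd v x + chd v x / e.
Proof.
move=> e1 hv hx A1.
have sq : Num.sqrt (chd v x ^+ 2 - 1) ^+ 2 = chd v x ^+ 2 - 1.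
  by rewrite sqr_sqrtr //; nra.
have s0 : 0 < Num.sqrt (chd v x ^+ 2 - 1) by rewrite sqrtr_gt0; nra.
case: (hv) (hx) => hv1 _ [hx1 _].
have -> : chd (geo v e x) x = (e + e^-1) / 2 * chd v x
   - (e - e^-1) / 2 * Num.sqrt (chd v x ^+ 2 - 1).
  rewrite [X in X = _]/chd /geo.
  move: sq s0; set sa := Num.sqrt _ => sq s0.
  rewrite !lorentzE hx1 lorentz_chd.
  transitivity ((e + e^-1) / 2 * chd v x
    - (e - e^-1) / 2 * ((chd v x ^+ 2 - 1) / sa)); first by ring.
  by rewrite -sq expr2 mulfK ?gt_eqF.
move: sq s0 A1; set A := chd v x; set sa := Num.sqrt _ => sq s0 A1.
have saA : sa <= A by apply: le_of_sqr; lra.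
have ei : 0 < e^-1 by rewrite invr_gt0; lra.
have -> : (e + e^-1) / 2 * A - (e - e^-1) / 2 * sa =
  e * ((A - sa) / 2) + e^-1 * ((A + sa) / 2) by field; lra.
rewrite [A / e]mulrC; apply: lerD; rewrite ler_pM2l //; try lra.
by rewrite -[leRHS]div1r ler_pdivlMr //; nra.
Qed.

(** The law of cosines, applied at v to the two pairs of points, gives
cosh (ln 2) + sinh s sinh t (1 - cos theta) for the left side, where s = ln e,
t = ln (2 e), and sinh a sinh b (1 - cos theta) <= M for a = d(v,x) and
b = d(v,y).  As cosh (ln 2) = 5 / 4, the bound does not depend on M once x and
y are far enough. *)
Lemma geo_thin v e x y M : 1 <= e -> H2 v -> H2 x -> H2 y ->
  chd x y <= M ->
  M * e <= Num.sqrt (chd v x ^+ 2 - 1) ->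
  2 * e <= Num.sqrt (chd v y ^+ 2 - 1) ->
  chd (geo v e x) (geo v (2 * e) y) <= 3.
Proof.
move=> e1 hv hx hy XM; have X1 := chd_ge1 hx hy.
have A1 := chd_ge1 hv hx; have B1 := chd_ge1 hv hy.
have sqx : Num.sqrt (chd v x ^+ 2 - 1) ^+ 2 = chd v x ^+ 2 - 1.
  by rewrite sqr_sqrtr //; nra.
have sqy : Num.sqrt (chd v y ^+ 2 - 1) ^+ 2 = chd v y ^+ 2 - 1.
  by rewrite sqr_sqrtr //; nra.
case: (hv) => hv1 _.
move=> hsa hsb; rewrite [X in X <= _]/chd /geo.
move: sqx sqy hsa hsb; set sa := Num.sqrt _; set sb := Num.sqrt _.
move=> sqx sqy hsa hsb.
have sa0 : 0 < sa by nra.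
have sb0 : 0 < sb by nra.
rewrite !lorentzE hv1 (lorentzC x v) !lorentz_chd.
move: X1 A1 B1 XM sqx sqy; set X := chd x y; set A := chd v x; set B := chd v y.
move=> X1 A1 B1 XM sqx sqy.
set sh := (e - e^-1) / 2; set sh' := (2 * e - (2 * e)^-1) / 2.
set ch := (e + e^-1) / 2; set ch' := (2 * e + (2 * e)^-1) / 2.
have ei : e * e^-1 = 1 by rewrite mulfV ?gt_eqF //; lra.
have ei0 : 0 < e^-1 by rewrite invr_gt0; lra.
have i2 : (2 * e)^-1 = e^-1 / 2 by rewrite invfM mulrC.
have ei1 : e^-1 <= 1 by rewrite invf_le1; lra.
have chsh : ch * ch' - sh * sh' = 5 / 4.
  rewrite /ch /ch' /sh /sh' i2; transitivity (5 / 4 * (e * e^-1)); last by lra.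
  by field; lra.
have sh0 : 0 <= sh by rewrite /sh; lra.
have sh'0 : 0 <= sh' by rewrite /sh' i2; lra.
have she : sh <= e by rewrite /sh; lra.
have she' : sh' <= 2 * e by rewrite /sh' i2; lra.
have AB : sa * sb <= A * B.
  by apply: ler_pM; [exact: ltW | exact: ltW | |]; apply: le_of_sqr; lra.
have XA : sh * X / sa <= 1 by rewrite ler_pdivrMr // mul1r; nra.
have XA0 : 0 <= sh * X / sa by rewrite divr_ge0 // ?mulr_ge0 //; lra.
have YB : sh' / sb <= 1 by rewrite ler_pdivrMr // mul1r; nra.
have YB0 : 0 <= sh' / sb by rewrite divr_ge0 //; lra.
have t1 : sh * X / sa * (sh' / sb) <= 1 by rewrite mulr_ile1.
have t2 : sh * sh' <= sh / sa * (sh' / sb) * (A * B).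
  have -> : sh * sh' = sh / sa * (sh' / sb) * (sa * sb) by field; lra.
  by rewrite ler_wpM2l // mulr_ge0 // divr_ge0 //; lra.
rewrite [leLHS](_ : _ = ch * ch' - sh / sa * (sh' / sb) * (A * B)
  + sh * X / sa * (sh' / sb)); last by ring.
lra.
Qed.

End LorentzGeometry.

(** * Distances in graphs *)

Lemma dist_le_weaken (G : sgraph) m n (x y : G) :
  (m <= n)%N -> dist_le x y m -> dist_le x y n.
Proof. by move=> mn [l [w [lm h]]]; exists l, w; rewrite (leq_trans lm mn). Qed.

Lemma dist_le_refl (G : sgraph) m (x : G) : dist_le x x m.
Proof. by exists 0%N, (fun=> x). Qed.

Lemma dist_le_trans (G : sgraph) (x y z : G) m n :
  dist_le x y m -> dist_le y z n -> dist_le x z (m + n).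
Proof.
move=> [l [w [lm [w0 wl wadj]]]] [l' [w' [ln [w0' wl' wadj']]]].
exists (l + l')%N, (fun i => if (i <= l)%N then w i else w' (i - l)%N).
split; first exact: leq_add.
split=> [|| i il]; first by rewrite leq0n.
  case: leqP => h; last by rewrite addKn.
  have l'0 : l' = 0%N by apply/eqP; rewrite -leqn0 -(leq_add2l l) addn0.
  by rewrite l'0 addn0 wl -w0' -wl' l'0.
case: (ltngtP i l) => h; first exact: wadj.
  by rewrite subSn ?(ltnW h) //; apply: wadj'; rewrite ltn_subLR // ltnW.
rewrite h wl -w0' -[X in adj X _]/(w' 0%N) subSnn.
by apply: wadj'; rewrite -(ltn_add2l l) addn0 -{1}h.
Qed.

(** * The pursuit in a coarse model of the hyperbolic plane *)

Section Game.
Variables (R : realType) (G : sgraph) (phi : G -> 'rV[R]_3) (D : R).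
Local Notation H2 := (@H2 R).
(** Together these say that phi is a coarse equivalence from G to the
hyperbolic plane. *)
Hypothesis phiH2 : forall g, H2 (phi g).
Hypothesis D_ge1 : 1 <= D.
Hypothesis phi_adj : forall x y : G, adj x y -> chd (phi x) (phi y) <= D.
Hypothesis phi_cobounded :
  forall z, H2 z -> exists g, chd (phi g) z <= D.
Hypothesis phi_coarse : forall T : R, exists N : nat,
  forall x y, chd (phi x) (phi y) <= T -> dist_le x y N.

Lemma chd_of_dist m (x y : G) : dist_le x y m ->
  chd (phi x) (phi y) <= (2 * D) ^+ m.
Proof.
case=> l [w [lm [<- <- wadj]]].
have D2 : 1 <= 2 * D by have := D_ge1; lra.
apply: le_trans (ler_weXn2l D2 lm).
elim: l wadj {lm} => [|l IH] wadj; first by rewrite chdxx.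
have h1 : chd (phi (w 0)) (phi (w l)) <= (2 * D) ^+ l.
  by apply: IH => i il; apply: wadj; exact: ltnW.
have h2 : chd (phi (w l)) (phi (w l.+1)) <= D by exact/phi_adj/wadj.
apply: le_trans (chd_chain (phiH2 _) (phiH2 _) (phiH2 _) h1 h2) _.
by rewrite exprSr [2 * _]mulrC mulrA.
Qed.

Section Pursuit.
Variables (v : G) (sigma : nat) (near_vertex : 'rV[R]_3 -> G).

Definition target (k : nat) (x : G) : G :=
  near_vertex (geo (phi v) (2 ^+ k) (phi x)).

(** The state is the number of the stage and the position of the cop.  The cop
stays in place when its target is out of reach, so that the strategy is legal
against any history, including those that no play produces. *)
Definition cop_step (st : nat * G) (x : G) : nat * G :=
  (st.1.+1, if `[< dist_le st.2 (target st.1.+1 x) sigma >]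
            then target st.1.+1 x else st.2).

Definition pursuit (h : seq G) : G := (foldl cop_step (0%N, v) h).2.

Lemma pursuit_rcons h x : pursuit (rcons h x) =
  if `[< dist_le (pursuit h) (target (size h).+1 x) sigma >]
  then target (size h).+1 x else pursuit h.
Proof.
rewrite /pursuit foldl_rcons /cop_step /=.
suff -> : (foldl cop_step (0%N, v) h).1 = size h by [].
by elim/last_ind: h => // h y IH; rewrite foldl_rcons size_rcons /= IH.
Qed.

Lemma pursuit_legal : legal_strategy sigma (fun h (_ : 'I_1) => pursuit h).
Proof.
move=> h x i; rewrite pursuit_rcons.
by case: asboolP => // _; exact: dist_le_refl.
Qed.

End Pursuit.

(** The robber is far at time k when chd v r_k >= K 2^k.  While it has always
been far, thinness of geodesics keeps the cop on its target.  The first time it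
is not far, it is within a bounded distance of the cop (which is still at v if
this time is 0) and gets captured in the next stage.  So an uncaptured robber is
always far. *)
Theorem coarse_model_strong_cop_win : strong_cop_win G 1.
Proof.
have [v0|noG] := pselect (exists v : G, True); last first.
  exists 1%N; split=> // psi _; exists 0%N => rad _ v.
  by case: noG; exists v.
have nearE z : exists g, H2 z -> chd (phi g) z <= D.
  case: v0 => v0 _; have [hz|nz] := pselect (H2 z); last by exists v0.
  by have [g hg] := phi_cobounded hz; exists g.
have [near_vertex nearP] := choice nearE.
have D1 := D_ge1.
(* Consecutive targets approximate, up to D, points at chd at most 3. *)
have [s hs] := phi_coarse (2 * (2 * D * 3) * D).
exists s.+1; split=> // psi _.
set S : R := (2 * D) ^+ s.+1.
set M : R := (2 * D) ^+ psi.
have D2 : 1 <= 2 * D by have := D_ge1; lra.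
have S1 : 1 <= S by rewrite exprn_ege1.
have M1 : 1 <= M by rewrite exprn_ege1.
(* Being far bounds sinh d(v, r_k) below by M 2^(k+1), as [geo_thin] asks. *)
pose K := 2 * M + 1.
(* Bounds the chd from a robber about to lose its margin to the geodesic
   point. *)
pose Q := 1 + 2 * M * K.
have K1 : 1 <= K by rewrite /K; lra.
have Q1 : 1 <= Q by rewrite /Q; nra.
(* The chain robber, its previous position, the geodesic point, the cop, the
   cop one stage later. *)
have [rho hrho] := phi_coarse (2 * (2 * (2 * M * Q) * D) * S).
exists rho => rad _ v; exists (fun h _ => pursuit v s.+1 near_vertex h).
split; first exact: pursuit_legal.
move=> r play; rewrite /cops_win.
set strat := fun h (_ : 'I_1) => pursuit v s.+1 near_vertex h.
have [cap|nocap] := pselect (exists k, captured rho strat r k); first by left.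
right; have ncap k : ~ captured rho strat r k.
  by move=> c; apply: nocap; exists k.
have move_le k : chd (phi (r k)) (phi (r k.+1)) <= M.
  have [//|l [w [lpsi rw _]]] := play k.
  by apply: chd_of_dist; exists l, w.
pose c k := pursuit v s.+1 near_vertex (mkseq r k).
have cS k : c k.+1 =
    if `[< dist_le (c k) (target v near_vertex k.+1 (r k)) s.+1 >]
    then target v near_vertex k.+1 (r k) else c k.
  by rewrite /c mkseqS pursuit_rcons size_mkseq.
have c_step k : chd (phi (c k)) (phi (c k.+1)) <= S.
  apply: chd_of_dist; rewrite cS; case: asboolP => // _; exact: dist_le_refl.
have escape k :
    ~ chd (phi (r k)) (phi (c k.+1)) <= 2 * (2 * (2 * M * Q) * D) * S.
  by move=> /hrho h; apply: (ncap k); exists ord0.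
have e1 k : 1 <= 2 ^+ k :> R by rewrite exprn_ege1 // ler1n.
pose far k := K * 2 ^+ k <= chd (phi v) (phi (r k)).
have far1 k : far k -> 1 < chd (phi v) (phi (r k)).
  rewrite /far /K => h; have := e1 k; nra.
have geoH2 k : far k -> H2 (geo (phi v) (2 ^+ k.+1) (phi (r k))).
  by move=> fk; apply: H2_geo => //; exact: far1.
have target_near k : far k ->
    chd (phi (target v near_vertex k.+1 (r k)))
        (geo (phi v) (2 ^+ k.+1) (phi (r k))) <= D.
  by move=> fk; apply: nearP; exact: geoH2.
have on_target k : (forall j, (j <= k)%N -> far j) ->
    c k.+1 = target v near_vertex k.+1 (r k).
  elim: k => [|k IH] allfar.
    rewrite cS asboolT //; apply: (dist_le_weaken (leqnSn s)); apply: hs.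
    have f0 := allfar 0%N isT.
    (* The cop stands at v, at distance ln 2 from the first geodesic point. *)
    have h0 : chd (phi v) (geo (phi v) (2 ^+ 1) (phi (r 0))) <= 2 * 3.
      by rewrite chd_geol // expr1; lra.
    have h1 := target_near 0%N f0; rewrite chdC in h1.
    apply: le_trans (chd_chain (phiH2 _) (geoH2 _ f0) (phiH2 _) h0 h1) _.
    by nra.
  have fk := allfar k (leqnSn k); have fSk := allfar k.+1 (leqnn _).
  rewrite cS asboolT //; apply: (dist_le_weaken (leqnSn s)); apply: hs.
  rewrite IH => [|j jk]; last by apply: allfar; exact: leqW.
  have h1 := target_near k fk.
  have h2 := target_near k.+1 fSk; rewrite chdC in h2.
  have h3 : chd (geo (phi v) (2 ^+ k.+1) (phi (r k)))
                (geo (phi v) (2 ^+ k.+2) (phi (r k.+1))) <= 3.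
    rewrite [2 ^+ k.+2]exprS; apply: (@geo_thin _ _ _ _ _ M) => //.
    - apply: le_sqrt_chd; first by (rewrite mulr_ge0 ?exprn_ge0 //; lra).
      apply: le_trans fk; rewrite /K exprS; have := e1 k; nra.
    - apply: le_sqrt_chd; first by (rewrite mulr_ge0 ?exprn_ge0 //; lra).
      apply: le_trans fSk; rewrite /K; have := e1 k.+1; nra.
  have h4 := chd_chain (phiH2 _) (geoH2 _ fk) (geoH2 _ fSk) h1 h3.
  by apply: le_trans (chd_chain (phiH2 _) (geoH2 _ fSk) (phiH2 _) h4 h2) _.
have all_far k : far k.
  elim/ltn_ind: k => -[_|k IH]; rewrite /far.
    rewrite leNgt expr0 mulr1; apply/negP => h; apply: (escape 0%N).
    have := c_step 0%N; rewrite chdC in h.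
    move/(chd_chain (phiH2 _) (phiH2 v) (phiH2 _) (ltW h)) => h1.
    apply: le_trans h1 _; rewrite ler_pM2r; last by lra.
    have KQ : K <= Q by rewrite /Q; nra.
    have QM : Q <= M * Q by rewrite ler_peMl //; lra.
    have QD : M * Q <= M * Q * D by rewrite ler_peMr //; lra.
    lra.
  have fk : far k by exact: IH.
  rewrite leNgt; apply/negP => h; apply: (escape k.+1).
  have cE : c k.+1 = target v near_vertex k.+1 (r k).
    by apply: on_target => j jk; apply: IH; rewrite ltnS.
  have h1 := move_le k; rewrite chdC in h1.
  have h2 : chd (phi (r k)) (geo (phi v) (2 ^+ k.+1) (phi (r k))) <= Q.
    rewrite chdC; apply: le_trans (chd_geo_end _ _ _ _) _ => //.
      exact: far1.
    have := fk; rewrite /far; have A1 := far1 k fk; have ek := e1 k.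
    (* The robber was far at stage k, so the geodesic point is not beyond it;
       it is not far at stage k.+1, so the point is not much before it. *)
    have : chd (phi v) (phi (r k)) <= 2 * (K * 2 ^+ k.+1) * M.
      by apply: (chd_chain (phiH2 _) (phiH2 _) (phiH2 _) (ltW h)); rewrite chdC.
    rewrite exprS; move: A1 ek; set A := chd _ _; set e := 2 ^+ k.
    move=> A1 ek AM KA.
    have e0 : 0 < 2 * e by lra.
    rewrite /Q lerD // ler_pdivrMr ?mul1r //; try lra.
    by apply: le_trans KA; rewrite ler_wpM2r // /K; lra.
  have h3 := target_near k fk; rewrite -cE chdC in h3.
  have h4 := chd_chain (phiH2 _) (phiH2 _) (geoH2 _ fk) h1 h2.
  have h5 := chd_chain (phiH2 _) (geoH2 _ fk) (phiH2 _) h4 h3.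
  by have := chd_chain (phiH2 _) (phiH2 _) (phiH2 _) h5 (c_step k.+1).
have [N hN] : exists N : nat, (2 * D) ^+ rad < 2 ^+ N.
  exists (Num.truncn ((2 * D) ^+ rad)).+1.
  apply: lt_le_trans (truncnS_gt _) _.
  by rewrite -natrX ler_nat ltnW // ltn_expl.
exists N.+1; split=> // k Nk /chd_of_dist h.
have := all_far k; rewrite /far leNgt => /negP; apply.
apply: le_lt_trans h _; apply: lt_le_trans hN _.
apply: (@le_trans _ _ (2 ^+ k)); first by rewrite ler_weXn2l ?ler1n // ltnW.
by rewrite ler_peMl ?exprn_ge0 // /K; lra.
Qed.

End Game.

(** * Hulls, balls and chords in the hyperboloid *)

Section Hull.
Variable R : realType.
Local Notation pt := 'rV[R]_3.
Local Notation H2 := (@H2 R).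
Implicit Types (a b c n u v w x y z : pt) (s t r e : R).

Lemma hhull3 m (v : 'I_m -> pt) k1 k2 k3 z (al be ga : R) :
  H2 z -> 0 <= al -> 0 <= be -> 0 <= ga ->
  z = al *: v k1 + be *: v k2 + ga *: v k3 -> hhull v z.
Proof.
move=> hz al0 be0 ga0 zE; split=> //.
pose d (k i : 'I_m) : R := (i == k)%:R.
exists (fun i => al * d k1 i + be * d k2 i + ga * d k3 i); split=> [i|].
  by rewrite !addr_ge0 ?mulr_ge0 ?ler0n.
have dE k : \sum_i d k i *: v i = v k.
  rewrite (bigD1 k) //= /d eqxx scale1r big1 ?addr0 // => i /negbTE ->.
  by rewrite scale0r.
rewrite zE; under eq_bigr do rewrite !scalerDl -!scalerA.
by rewrite !big_split /= -!scaler_sumr !dE.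
Qed.

Lemma hhull_vertex m (v : 'I_m -> pt) k : H2 (v k) -> hhull v (v k).
Proof.
move=> hk.
apply: (hhull3 (k1 := k) (k2 := k) (k3 := k) hk ler01 (lexx 0) (lexx 0)).
by rewrite scale1r !scale0r !addr0.
Qed.

(** Pairing x = sum_j a_j v_j with x itself gives
1 = sum_j a_j cosh d(v_j, x), and every term is at least a_j. *)
Lemma hhull_coef_le1 m (v : 'I_m -> pt) (al : 'I_m -> R) i :
  (forall i, H2 (v i)) -> (forall i, 0 <= al i) ->
  H2 (\sum_i al i *: v i) -> al i <= 1.
Proof.
move=> hv al0 hx; have c1 j := chd_ge1 (hv j) hx.
have sumE : 1 = \sum_j al j * chd (v j) (\sum_i al i *: v i).
  rewrite -[LHS](chdxx hx) {1}/chd lorentz_suml -sumrN.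
  by apply: eq_bigr => j _; rewrite lorentzZl -mulrN.
rewrite sumE (bigD1 i) //=.
apply: (@le_trans _ _ (al i * chd (v i) (\sum_i al i *: v i))).
  by rewrite ler_peMr.
by rewrite lerDl sumr_ge0 // => j _; rewrite mulr_ge0 // (le_trans _ (c1 j)).
Qed.

Lemma hhull_bounded m (v : 'I_m -> pt) : (forall i, H2 (v i)) ->
  exists D, forall x y, hhull v x -> hhull v y -> chd x y <= D.
Proof.
move=> hv; exists (\sum_i \sum_j chd (v i) (v j)) => x y.
move=> [hx [al [al0 xE]]] [hy [be [be0 yE]]]; subst x y.
rewrite {1}/chd lorentz_suml -sumrN; apply: ler_sum => i _.
rewrite lorentz_sumr -sumrN; apply: ler_sum => j _.
rewrite lorentzZl lorentzZr mulrA -mulrN -/(chd _ _).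
have c1 := chd_ge1 (hv i) (hv j).
rewrite ler_piMl; [by [] | lra | apply: mulr_ile1 => //].
  exact: (hhull_coef_le1 (v := v)).
exact: (hhull_coef_le1 (v := v)).
Qed.

(** The central projection of a timelike vector to the hyperboloid. *)
Definition unit_vec u : pt := (Num.sqrt (- lorentz u u))^-1 *: u.

Lemma H2_unit u : lorentz u u < 0 -> 0 < u 0 0 -> H2 (unit_vec u).
Proof.
move=> uu u0; have s0 : 0 < Num.sqrt (- lorentz u u).
  by rewrite sqrtr_gt0 oppr_gt0.
have sq : Num.sqrt (- lorentz u u) ^+ 2 = - lorentz u u.
  by rewrite sqr_sqrtr // oppr_ge0 ltW.
split; last by rewrite mxE mulr_gt0 // invr_gt0.
rewrite /unit_vec !lorentzE; move: s0 sq; set s := Num.sqrt _ => s0 sq.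
by rewrite -[lorentz u u]opprK -sq; field; lra.
Qed.

Lemma unit_vecK u : lorentz u u < 0 ->
  u = Num.sqrt (- lorentz u u) *: unit_vec u.
Proof.
by move=> uu; rewrite /unit_vec scalerA mulfV ?scale1r // gt_eqF // sqrtr_gt0
  oppr_gt0.
Qed.

(** Open half-spaces are open for the hyperbolic distance.  By [gram_schwarz],
the value at z differs from chd c z times the value at c by at most a multiple
of sinh d(c, z). *)
Lemma lorentz_ge0_near n c : H2 c -> 0 < lorentz n c ->
  exists r, 0 < r /\
    forall z, H2 z -> chd c z <= 1 + r -> 0 <= lorentz n z.
Proof.
move=> hc f0; set f := lorentz n c in f0 *.
set N := lorentz n n + f ^+ 2.
pose r := Num.min 1 (f ^+ 2 / (3 * (`|N| + 1))).
have N1 : 0 < 3 * (`|N| + 1) by have := normr_ge0 N; lra.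
have r0 : 0 < r by rewrite lt_min ltr01 divr_gt0 ?exprn_gt0.
have r1 : r <= 1 by rewrite ge_min lexx.
have r2 : r * (3 * (`|N| + 1)) <= f ^+ 2.
  by rewrite -ler_pdivlMr // ge_min lexx orbT.
exists r; split=> // z hz cz; rewrite leNgt; apply/negP => g0.
have := gram_schwarz n (proj1 hc) (proj1 hz).
have c1 := chd_ge1 hc hz.
rewrite (lorentz_chd z c) (chdC z) -/f -/N.
move: g0 cz c1; set g := lorentz n z; set B := chd c z => g0 cz c1.
have B1 : B ^+ 2 - 1 <= 3 * r by nra.
have B0 : 0 <= B ^+ 2 - 1 by nra.
have NN : N <= `|N| := ler_norm N.
have N0 : 0 <= `|N| := normr_ge0 N.
have : N * (B ^+ 2 - 1) <= f ^+ 2 - r.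
  apply: (@le_trans _ _ (`|N| * (3 * r))); last by lra.
  apply: (@le_trans _ _ (`|N| * (B ^+ 2 - 1))).
    exact: ler_wpM2r.
  exact: ler_wpM2l.
have fB : f <= f * B by rewrite ler_peMr // ltW.
have -> : g + f * - B = - (f * B - g) by ring.
have : f ^+ 2 <= (f * B - g) ^+ 2 by rewrite ler_sqr ?nnegrE; lra.
by rewrite !sqrrN; lra.
Qed.

(** The Lorentz cross product: the normal of the plane spanned by b and c. *)
Definition cross b c : pt :=
  \row_(i < 3) nth 0 [:: - (b 0 1 * c 0 2%:R - b 0 2%:R * c 0 1);
    - (b 0 0 * c 0 2%:R - b 0 2%:R * c 0 0);
    b 0 0 * c 0 1 - b 0 1 * c 0 0] i.

Lemma lorentz_cross b c z : lorentz (cross b c) z = det3 z b c.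
Proof. rewrite /lorentz /det3 /cross !mxE /=; ring. Qed.

(** Around the barycentre of a nondegenerate triangle the three barycentric
coordinates, given by Cramer's rule, remain nonnegative. *)
Lemma interior_ball a b c : H2 a -> H2 b -> H2 c -> det3 a b c != 0 ->
  exists o r, [/\ H2 o, 0 < r, r <= 1 &
    forall z, H2 z -> chd o z <= 1 + r ->
    exists al be ga, [/\ 0 <= al, 0 <= be, 0 <= ga &
                       z = al *: a + be *: b + ga *: c]].
Proof.
move=> ha hb hc; set d := det3 a b c => d0; pose u := a + b + c.
have uu : lorentz u u < 0.
  rewrite /u !lorentzE !lorentz_chd !chdxx //.
  have := chd_ge1 ha hb; have := chd_ge1 ha hc; have := chd_ge1 hb hc.
  rewrite !(chdC c) (chdC b a); lra.
have ho : H2 (unit_vec u).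
  apply: H2_unit => //; rewrite /u !mxE.
  by case: ha => _; case: hb => _; case: hc => _; lra.
have k0 : 0 < (Num.sqrt (- lorentz u u))^-1.
  by rewrite invr_gt0 sqrtr_gt0 oppr_gt0.
have near n : lorentz n u = d -> exists r, 0 < r /\
    forall z, H2 z -> chd (unit_vec u) z <= 1 + r -> 0 <= lorentz n z / d.
  move=> nu.
  have f0 : 0 < lorentz (d^-1 *: n) (unit_vec u).
    by rewrite lorentzZl lorentzZr nu mulrCA mulVf // mulr1.
  have [r [r0 hr]] := lorentz_ge0_near ho f0.
  exists r; split=> // z hz cz.
  by have := hr z hz cz; rewrite lorentzZl mulrC.
have [|r1 [r10 h1]] := near (cross b c).
  by rewrite lorentz_cross /u /d /det3 !mxE; ring.
have [|r2 [r20 h2]] := near (cross c a).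
  by rewrite lorentz_cross /u /d /det3 !mxE; ring.
have [|r3 [r30 h3]] := near (cross a b).
  by rewrite lorentz_cross /u /d /det3 !mxE; ring.
exists (unit_vec u), (Num.min 1 (Num.min r1 (Num.min r2 r3))); split=> //.
- by rewrite !lt_min ltr01 r10 r20 r30.
- by rewrite ge_min lexx.
move=> z hz cz.
have le_r r : Num.min 1 (Num.min r1 (Num.min r2 r3)) <= r ->
    chd (unit_vec u) z <= 1 + r.
  by move=> h; apply: le_trans cz _; rewrite lerD2l.
exists (lorentz (cross b c) z / d), (lorentz (cross c a) z / d),
  (lorentz (cross a b) z / d).
split; first by apply: h1 => //; apply: le_r; rewrite !ge_min lexx ?orbT.
- by apply: h2 => //; apply: le_r; rewrite !ge_min lexx ?orbT.
- by apply: h3 => //; apply: le_r; rewrite !ge_min lexx ?orbT.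
apply: (scalerI d0); rewrite (cramer3 a b c z) !scalerDr !scalerA.
by rewrite !lorentz_cross ![d * _]mulrC !divfK //; congr (_ + _ *: _ + _ *: _);
  rewrite /det3; ring.
Qed.

Lemma lorentz_shift c v e : H2 c -> H2 v -> 0 <= e ->
  lorentz (c + e *: v) (c + e *: v) <= -1.
Proof.
move=> hc hv e0; rewrite !lorentzE !lorentz_chd !chdxx //.
have := chd_ge1 hc hv; rewrite (chdC v); nra.
Qed.

(** Moving from c slightly towards each of three independent points stays in
the ball; if the ball lay in a plane, that plane would contain all three. *)
Lemma ball_not_in_plane c r x y v0 v1 v2 : H2 c -> 0 < r ->
  H2 v0 -> H2 v1 -> H2 v2 -> det3 v0 v1 v2 != 0 ->
  ~ (forall z, H2 z -> chd c z <= 1 + r -> exists s t, z = s *: x + t *: y).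
Proof.
move=> hc r0 h0 h1 h2 d0 plane.
have [s [t cE]] : exists s t, c = s *: x + t *: y.
  by apply: plane => //; rewrite chdxx //; lra.
have span v : H2 v -> exists s t, v = s *: x + t *: y.
  move=> hv; have b1 := chd_ge1 hc hv.
  pose e := r / chd c v; pose u := c + e *: v.
  have e0 : 0 < e by rewrite divr_gt0 //; lra.
  have uu := lorentz_shift hc hv (ltW e0); rewrite -/u in uu.
  have hu : H2 (unit_vec u).
    apply: H2_unit; first by lra.
    by rewrite !mxE; case: hc hv => _ c0 [_ v00]; rewrite addr_gt0 // mulr_gt0.
  have cu : chd c (unit_vec u) <= 1 + r.
    rewrite /unit_vec [leLHS]/chd lorentzZr -mulrN -/(chd c u).
    have -> : chd c u = 1 + r.
      rewrite /chd /u lorentzDr lorentzZr opprD -mulrN -!/(chd _ _) chdxx //.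
      by rewrite /e divfK // gt_eqF //; lra.
    rewrite ler_piMl //; first by lra.
    rewrite invf_le1 ?sqrtr_gt0; last by lra.
    by rewrite -{1}sqrtr1 ler_sqrt; lra.
  have [s' [t' uE]] := plane _ hu cu.
  have uK : u = Num.sqrt (- lorentz u u) *: unit_vec u by apply: unit_vecK; lra.
  set q := Num.sqrt _ in uK.
  exists ((q * s' - s) / e), ((q * t' - t) / e).
  have -> : v = e^-1 *: (u - c).
    by rewrite /u addrC addKr scalerA mulVf ?scale1r // gt_eqF.
  rewrite uK uE cE.
  by apply: pt_eqP; rewrite !mxE; ring.
have [s0 [t0 E0]] := span _ h0; have [s1 [t1 E1]] := span _ h1.
have [s2 [t2 E2]] := span _ h2.
move/eqP: d0; apply; rewrite E0 E1 E2 /det3 !mxE; ring.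
Qed.

Lemma hsegment_endl x y : H2 x -> hsegment x y x.
Proof.
by move=> hx; split=> //; exists 1, 0; rewrite scale1r scale0r addr0 ler01.
Qed.

Lemma hsegmentC x y : hsegment x y = hsegment y x.
Proof.
by apply/seteqP; split=> z [hz [s [t [s0 t0 zE]]]]; split=> //; exists t, s;
  rewrite addrC.
Qed.

Lemma H2_scale_inj x s : H2 x -> H2 (s *: x) -> s *: x = x.
Proof.
move=> [hx x0] [hsx]; rewrite mxE => sx0.
move: hsx; rewrite !lorentzE hx => hs.
have s0 : 0 < s by rewrite -(pmulr_lgt0 _ x0).
have /eqP : (s - 1) * (s + 1) = 0 by lra.
rewrite mulf_eq0 (gt_eqF (_ : 0 < s + 1)) ?orbF; last by lra.
by rewrite subr_eq0 => /eqP ->; rewrite scale1r.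
Qed.

Lemma H2_indep x y s t : H2 x -> H2 y -> x <> y -> 0 <= t ->
  x = s *: x + t *: y -> t = 0.
Proof.
move=> hx hy xy t0 E; apply/eqP; rewrite eq_le t0 andbT leNgt.
apply/negP => tp; apply: xy.
have yE : y = ((1 - s) / t) *: x.
  rewrite mulrC -scalerA scalerBl scale1r {1}E addrAC subrr add0r scalerA.
  by rewrite mulVf ?scale1r // gt_eqF.
by rewrite yE; apply/esym/H2_scale_inj => //; rewrite -yE.
Qed.

(** End points are the extreme points of a segment: if a = s c + t d with c
and d themselves nonnegative combinations of a and b, then one of s, t
vanishes or c, d are multiples of a. *)
Lemma hsegment_eq_endl a b c d : H2 a -> H2 b -> H2 c -> H2 d -> a <> b ->
  hsegment a b = hsegment c d -> a = c \/ a = d.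
Proof.
move=> ha hb hc hd ab E.
have [_ [s [t [s0 t0 aE]]]] : hsegment c d a.
  by rewrite -E; exact: hsegment_endl.
have [_ [s1 [t1 [s10 t10 cE]]]] : hsegment a b c.
  by rewrite E; exact: hsegment_endl.
have [_ [s2 [t2 [s20 t20 dE]]]] : hsegment a b d.
  by rewrite E hsegmentC; exact: hsegment_endl.
have z0 : s * t1 + t * t2 = 0.
  apply: (H2_indep (s := s * s1 + t * s2) ha hb ab).
    by rewrite addr_ge0 ?mulr_ge0.
  by rewrite {1}aE cE dE !scalerDr !scalerDl !scalerA addrACA.
have [s00|sn] := eqVneq s 0.
  right; move: aE; rewrite s00 scale0r add0r => aE.
  by rewrite aE; apply: H2_scale_inj => //; rewrite -aE.
left; have t1z : t1 = 0.
  have : s * t1 = 0 by have := mulr_ge0 s0 t10; have := mulr_ge0 t0 t20; lra.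
  by move/eqP; rewrite mulf_eq0 (negbTE sn) => /eqP.
move: cE; rewrite t1z scale0r addr0 => cE.
by rewrite cE; apply/esym/H2_scale_inj => //; rewrite -cE.
Qed.

(** Points within bounded distance of o have bounded coordinates, and
2 (chd y z - 1) is at most the squared Euclidean distance of the last two
coordinates of y and z.  So separated points lie in distinct cells of a fine
enough square grid. *)
Lemma separated_bounded o T r : H2 o -> 0 < r -> exists M : nat,
  forall m (y : 'I_m -> pt), (forall i, H2 (y i)) ->
    (forall i, chd o (y i) <= T) ->
    (forall i j, i != j -> 1 + r < chd (y i) (y j)) -> (m <= M)%N.
Proof.
move=> ho r0.
pose e0 : pt := \row_i (i == 0)%:R.
have he0 : H2 e0 by split; rewrite /lorentz !mxE /=; lra.
have e0E z : chd e0 z = z 0 0 by rewrite /chd /lorentz !mxE /=; ring.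
pose Y := 2 * chd e0 o * T.
pose s := Num.min 1 r.
have s0 : 0 < s by rewrite lt_min ltr01.
have ss : s ^+ 2 <= r.
  have s1 : s <= 1 by rewrite ge_min lexx.
  have sr : s <= r by rewrite ge_min lexx orbT.
  nra.
pose n := Num.truncn ((2 * Y) / s).
exists (n.+1 * n.+1)%N => m y hy oy sep.
have yY i : y i 0 0 <= Y.
  by rewrite -e0E; apply: chd_chain he0 ho (hy i) (lexx _) (oy i).
have coord i : (- Y <= y i 0 1 <= Y) && (- Y <= y i 0 2%:R <= Y).
  have := yY i; case: (hy i); rewrite /lorentz => h p0 pY.
  by apply/andP; split; rewrite -ler_norml; apply: le_of_sqr; try lra;
    rewrite real_normK ?num_real //; nra.
pose cell (k : 'I_3) i : 'I_n.+1 := inord (Num.truncn ((y i 0 k + Y) / s)).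
have cellP k i j : - Y <= y i 0 k <= Y -> - Y <= y j 0 k <= Y ->
    cell k i = cell k j -> (y i 0 k - y j 0 k) ^+ 2 < s ^+ 2.
  move=> hi hj /(congr1 (@nat_of_ord n.+1)); rewrite /cell !inordK; last 2 first.
  - by rewrite ltnS le_truncn // ler_pM2r ?invr_gt0 //; lra.
  - by rewrite ltnS le_truncn // ler_pM2r ?invr_gt0 //; lra.
  move=> tE.
  have bi : 0 <= (y i 0 k + Y) / s by rewrite divr_ge0 //; lra.
  have bj : 0 <= (y j 0 k + Y) / s by rewrite divr_ge0 //; lra.
  have /andP[i1 i2] := truncn_itv bi; have /andP[j1 j2] := truncn_itv bj.
  rewrite tE in i1 i2.
  have E q : y q 0 k = (y q 0 k + Y) / s * s - Y.
    by rewrite divfK ?gt_eqF //; ring.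
  rewrite (E i) (E j); move: i1 i2 j1 j2; rewrite -natr1.
  set ai := (y i 0 k + Y) / s; set aj := (y j 0 k + Y) / s.
  set N := _%:R => i1 i2 j1 j2.
  have -> : ai * s - Y - (aj * s - Y) = (ai - aj) * s by ring.
  rewrite exprMn gtr_pMl ?exprn_gt0 //; nra.
have inj : injective (fun i => (cell 1 i, cell 2%:R i)).
  move=> i j [c1 c2]; apply/eqP; apply/negPn/negP => ij.
  have /andP[i1 i2] := coord i; have /andP[j1 j2] := coord j.
  have h1 := cellP _ _ _ i1 j1 c1; have h2 := cellP _ _ _ i2 j2 c2.
  have := sep _ _ ij; have := sqr_ge0 (y i 0 0 - y j 0 0).
  have [hi _] := hy i; have [hj _] := hy j.
  move: hi hj h1 h2; rewrite /chd /lorentz !expr2; lra.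
by have := leq_card _ inj; rewrite card_prod !card_ord.
Qed.

(** The part of [0, 1] covered by the sets reachable from i0 and the part
covered by the others are closed, disjoint and cover the interval, so the second
one is empty. *)
Lemma segment_cover_connect m (A : 'I_m -> set R) i0 j0 :
  (forall i, closed (A i)) -> `[0, 1]%classic `<=` \bigcup_i A i ->
  A i0 0 -> A j0 1 ->
  connect (fun i j => `[< exists t, A i t /\ A j t >]) i0 j0.
Proof.
move=> cA cov A0 A1; set e : rel 'I_m := (fun i j => _).
pose U := \bigcup_(i in [set i | connect e i0 i]) A i.
pose W := \bigcup_(i in [set i | ~~ connect e i0 i]) A i.
have cU : closed U by apply: closed_bigcup => // ; exact: finite_finset.
have cW : closed W by apply: closed_bigcup => // ; exact: finite_finset.
have UW t : U t -> W t -> False.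
  move=> [i /= ca Aa] [j /= nb Ab]; case/negP: nb.
  by apply: connect_trans ca (connect1 _); apply/asboolP; exists t.
have : `[0, 1]%classic `&` U = `[0, 1]%classic.
  apply: (@segment_connected R 0 1).
  - exists 0; split; first by rewrite /= in_itv /= lexx ler01.
    by exists i0 => //; exact: connect0.
  - exists (~` W); first by rewrite openC.
    apply/seteqP; split=> t [It Ht]; split=> //.
      by move=> Wt; exact: UW Wt.
    have [i _ Aa] := cov t It.
    by case: (boolP (connect e i0 i)) => ca; [exists i | case: Ht; exists i].
  - by exists U.
move/seteqP => [_ /(_ 1)] []; first by rewrite /= in_itv /= lexx ler01.
move=> _ [i /= ca Aa]; apply: connect_trans ca (connect1 _).
by apply/asboolP; exists 1.
Qed.

(** The coefficients of a combination of points of [H2] are bounded by its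
first coordinate, so the cone may be replaced by the image of a compact cube. *)
Lemma cone_line_closed m (v : 'I_m.+1 -> pt) x y :
  (forall i, H2 (v i)) -> H2 x -> H2 y ->
  closed [set t : R | 0 <= t <= 1 /\ exists a : 'I_m.+1 -> R,
    (forall i, 0 <= a i) /\ (1 - t) *: x + t *: y = \sum_i a i *: v i].
Proof.
move=> hv hx hy; pose X := x 0 0 + y 0 0.
pose F (a : 'rV[R]_m.+1) : pt := \sum_i a 0 i *: v i.
pose w t : pt := (1 - t) *: x + t *: y.
pose K := F @` [set a : 'rV[R]_m.+1 | forall i, `[0, X]%classic (a ord0 i)].
have cK : closed K.
  apply: compact_closed; first exact: norm_hausdorff.
  apply: continuous_compact.
    apply: continuous_subspaceT; apply: continuous_big.
      exact: add_continuous.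
    move=> i _ a; apply: (@continuous_comp _ _ _ (fun a : 'rV[R]_m.+1 => a 0 i)
      (fun s => s *: v i)); first exact: coord_continuous.
    exact: scalel_continuous.
  apply: (@rV_compact R m.+1 (fun=> `[0, X]%classic)) => i.
  exact: segment_compact.
rewrite (_ : [set _ | _] = `[0, 1]%classic `&` w @^-1` K).
  apply: closedI; first exact: interval_closed.
  apply: preimage_closed => // t _.
  apply: cvgD; apply: cvgZr_tmp; last exact: cvg_id.
  by apply: cvgB; [exact: cvg_cst | exact: cvg_id].
apply/seteqP; split=> t /=.
  move=> [t01 [a [a0 wE]]]; split; first by rewrite in_itv.
  exists (\row_i a i); last first.
    by rewrite /F /w wE; apply: eq_bigr => i _; rewrite mxE.
  move=> i; rewrite /= in_itv /= mxE a0 /=.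
  have := congr1 (fun z : pt => z 0 0) wE; rewrite summxE !mxE => E.
  case: (hx) (hy) => _ x0 [_ y0]; case/andP: t01 => t0 t1.
  apply: (@le_trans _ _ ((1 - t) * x 0 0 + t * y 0 0)); last by rewrite /X; nra.
  rewrite E (bigD1 i) //= mxE.
  have v1 j := H2_time_ge1 (hv j).
  apply: (@le_trans _ _ (a i * v i 0 0)); first by rewrite ler_peMr.
  rewrite lerDl sumr_ge0 // => j _.
  by rewrite mxE mulr_ge0 // (le_trans _ (v1 j)).
move=> [t01 [a aX wE]]; split; first by move: t01; rewrite in_itv.
exists (fun i => a 0 i); split=> [i|]; last by rewrite -/(w t) -wE.
by have := aX i; rewrite /= in_itv /= => /andP[].
Qed.

(** The chord between x and y projects centrally onto the geodesic segment. *)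
Lemma segment_point x y t : H2 x -> H2 y -> 0 <= t <= 1 ->
  exists q z, [/\ 0 < q, H2 z, chd x z <= chd x y &
                 (1 - t) *: x + t *: y = q *: z].
Proof.
move=> hx hy /andP[t0 t1]; set u := (1 - t) *: x + t *: y.
have c1 := chd_ge1 hx hy.
have tc : 0 <= t * (1 - t) * (chd x y - 1) by rewrite !mulr_ge0; lra.
have uu : lorentz u u <= -1.
  rewrite /u !lorentzE !lorentz_chd !chdxx // (chdC y x); lra.
have uu0 : lorentz u u < 0 by lra.
have hu : H2 (unit_vec u).
  apply: H2_unit => //; rewrite !mxE.
  have x1 := H2_time_ge1 hx; have y1 := H2_time_ge1 hy.
  have : 0 <= (1 - t) * (x 0 0 - 1) by rewrite mulr_ge0; lra.
  have : 0 <= t * (y 0 0 - 1) by rewrite mulr_ge0; lra.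
  lra.
exists (Num.sqrt (- lorentz u u)), (unit_vec u); split=> //.
- by rewrite sqrtr_gt0 oppr_gt0.
- rewrite /unit_vec [leLHS]/chd lorentzZr -mulrN -/(chd x u).
  have cu : chd x u <= chd x y.
    by rewrite [leLHS]/chd /u lorentzDr !lorentzZr !lorentz_chd chdxx //; nra.
  have cu0 : 0 <= chd x u.
    by rewrite /chd /u lorentzDr !lorentzZr !lorentz_chd chdxx //; nra.
  apply: le_trans cu; rewrite ler_piMl // invf_le1 ?sqrtr_gt0; last by lra.
  by rewrite -{1}sqrtr1 ler_sqrt; lra.
exact: unit_vecK.
Qed.

End Hull.

(** * Tilings *)

Section Tiling.
Variables (R : realType) (p : nat) (I : Type) (P : I -> 'I_p.+3 -> 'rV[R]_3).
Local Notation pt := 'rV[R]_3.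
Local Notation H2 := (@H2 R).
Hypothesis P_convex : forall i, convex_polygon (P i).
Hypothesis P_congr : congruent_tiles P.
Hypothesis P_cover : \bigcup_i tile P i = H2.
Hypothesis P_edge : edge_to_edge P.

Lemma tile_vertex_H2 i k : H2 (P i k).
Proof. by case: (P_convex i). Qed.

(** In [convex_polygon], take for both remaining vertices the same one. *)
Lemma three_vertices_indep i :
  det3 (P i ord0) (P i (ordS ord0)) (P i (ordS (ordS ord0))) != 0.
Proof.
have [_ _ /(_ ord0 (ordS (ordS ord0)) (ordS (ordS ord0)))] := P_convex i.
rewrite !side_det3 => h; apply: contraTneq (h isT isT) => ->.
by rewrite mul0r ltxx.
Qed.

Lemma vertex_in_tile i k : tile P i (P i k).
Proof. exact/hhull_vertex/tile_vertex_H2. Qed.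

Lemma tile_H2 i z : tile P i z -> H2 z.
Proof. by case. Qed.

Lemma tile_exists z : H2 z -> exists i, tile P i z.
Proof. by rewrite -P_cover => -[i _ h]; exists i. Qed.

Lemma tiles_bounded : exists D, 1 <= D /\
  forall i x y, tile P i x -> tile P i y -> chd x y <= D.
Proof.
have [[i0]|noI] := pselect (exists i : I, True); last first.
  by exists 1; split=> // i; case: noI; exists i.
move=> _; have [D hD] := hhull_bounded (tile_vertex_H2 i0).
exists D; split=> [|i x y hx hy].
  by rewrite -(chdxx (tile_vertex_H2 i0 ord0)) hD //; exact: vertex_in_tile.
have [g [gi gE]] := P_congr i0 i.
move: hx hy; rewrite -gE => -[x' hx' <-] [y' hy' <-].
have [hx2 hy2] := (tile_H2 hx', tile_H2 hy').
by rewrite isometry_chd //; exact: hD.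
Qed.

Lemma tile_meet_planar i j : i <> j -> exists x y : pt,
  forall z, tile P i z -> tile P j z -> exists s t, z = s *: x + t *: y.
Proof.
move=> ij; have [e0|[k [l [_ e1]]]|[k [l [_ e2]]]] := P_edge ij.
- by exists 0, 0 => z zi zj; have : set0 z by rewrite -e0.
- exists (P i k), 0 => z zi zj.
  have -> : z = P i k by have : [set P i k] z by rewrite -e1.
  by exists 1, 0; rewrite scale1r scaler0 addr0.
- exists (P i k), (P i (ordS k)) => z zi zj.
  have : tile_edge P i k z by rewrite -e2.
  by case=> _ [s [t [_ _ ->]]]; exists s, t.
Qed.

Lemma touching_share_vertex i j z : tile P i z -> tile P j z ->
  exists k l, P i k = P j l.
Proof.
move=> zi zj; have [->|ij] := pselect (i = j); first by exists ord0, ord0.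
have [e0|[k [l [e1 _]]]|[k [l [e2 _]]]] := P_edge ij.
- by have : set0 z by rewrite -e0.
- by exists k, l.
have nk : P i k <> P i (ordS k) by case: (P_convex i).
have vH2 := tile_vertex_H2.
have [e|e] := hsegment_eq_endl (vH2 i _) (vH2 i _) (vH2 j _) (vH2 j _) nk e2.
  by exists k, l.
by exists k, (ordS l).
Qed.

(** Images under isometries of an interior point of one tile serve as centres
of all tiles.  If two centres were close, the tiles around them would share
a ball, against [tile_meet_planar].  To count tiles near x, an isometry that
carries the reference tile to a tile containing x pulls the centres back to the
neighbourhood of one fixed point. *)
Lemma tiles_locally_finite T : exists M : nat,
  forall (x : pt) m (f : 'I_m -> I), H2 x -> injective f ->
    (forall k, exists2 z, tile P (f k) z & chd x z <= T) -> (m <= M)%N.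
Proof.
have [[i0 _]|noI] := pselect (exists i : I, True); last first.
  by exists 0%N => x [|m] f // _ _; case: noI; exists (f ord0).
have vH2 := tile_vertex_H2.
have [ctr [r [ho r0 r1 ball]]] :=
  interior_ball (vH2 i0 _) (vH2 i0 _) (vH2 i0 _) (three_vertices_indep i0).
have ball_tile z : H2 z -> chd ctr z <= 1 + r -> tile P i0 z.
  move=> hz /(ball z hz) [al [be [ga [al0 be0 ga0 zE]]]].
  exact: hhull3 al0 be0 ga0 zE.
have [g gP] := choice (P_congr i0).
have gi (j : I) : H2_isometry (g j) by case: (gP j).
have gE (j : I) : g j @` tile P i0 = tile P j by case: (gP j).
pose c j := g j ctr.
have cH j : H2 (c j) by exact: isometry_H2.
have otile : tile P i0 ctr by apply: ball_tile => //; rewrite chdxx //; lra.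
have ctile j : tile P j (c j) by rewrite -gE; exists ctr.
have pull j z : H2 z -> exists2 y, H2 y & g j y = z.
  case: (gi j) => gH _ hz; have [y hy yE] : (g j @` H2) z by rewrite gH.
  by exists y.
have cball j z : H2 z -> chd (c j) z <= 1 + r -> tile P j z.
  move=> hz; have [y hy <-] := pull j z hz.
  rewrite isometry_chd // => h; rewrite -gE; exists y => //; exact: ball_tile.
have sep i j : i <> j -> 1 + r / 6 < chd (c i) (c j).
  move=> ij; rewrite ltNge; apply/negP => cij.
  have [x [y pl]] := tile_meet_planar ij.
  apply: (ball_not_in_plane (c := c j) (r := r / 6) (x := x) (y := y)
    (cH j) _ (vH2 i0 _) (vH2 i0 _) (vH2 i0 _) (three_vertices_indep i0)).
    by lra.
  move=> z hz cz; apply: pl; apply: cball => //; last by lra.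
  apply: le_trans (chd_triangle_small (cH i) (cH j) hz _ cij cz) _; lra.
have [D [D1 hD]] := tiles_bounded.
have r6 : 0 < r / 6 by lra.
have [M hM] := separated_bounded (2 * D * (2 * T * D)) ho r6.
exists M => x m f hx finj fT.
have [i xi] := tile_exists hx.
have yex k : exists y, H2 y /\ g i y = c (f k).
  by have [y hy yE] := pull i _ (cH (f k)); exists y.
have [y yP] := choice yex.
have yH k : H2 (y k) by case: (yP k).
have yE k : g i (y k) = c (f k) by case: (yP k).
apply: (hM m y) => // [k|k l kl].
  rewrite -(isometry_chd (gi i)) // yE -/(c i).
  have [z zk xz] := fT k.
  apply: (chd_chain _ hx) => //; first exact: hD (ctile i) xi.
  apply: (chd_chain hx (tile_H2 zk)) => //; exact: hD zk (ctile _).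
rewrite -(isometry_chd (gi i)) // !yE; apply: sep => /finj kl'.
by move: kl; rewrite kl' eqxx.
Qed.

(** A longest injective list of tiles near x contains all of them. *)
Lemma tiles_near_finite T : exists M : nat, forall x : pt, H2 x ->
  exists m (f : 'I_m -> I), (m <= M)%N /\
    forall i, (exists2 z, tile P i z & chd x z <= T) -> exists k, i = f k.
Proof.
have [M hM] := tiles_locally_finite T; exists M => x hx.
pose Q m := exists f : 'I_m -> I, injective f /\
  forall k, exists2 z, tile P (f k) z & chd x z <= T.
have Q0 : exists m, `[< Q m >].
  exists 0%N; apply/asboolP.
  exists (fun k : 'I_0 => False_rect I (notF (ltn_ord k))).
  by split=> [] [].
have QM m : `[< Q m >] -> (m <= M)%N.
  by move=> /asboolP [f [fi fT]]; exact: hM fT.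
case: (ex_maxnP Q0 QM) => m /asboolP [f [fi fT]] mmax.
exists m, f; split=> [|i iT]; first by apply: QM; apply/asboolP; exists f.
apply: contrapT => noti.
suff : (m.+1 <= m)%N by rewrite ltnn.
apply: mmax; apply/asboolP.
exists (fun k => if unlift ord_max k is Some k' then f k' else i); split.
  move=> k l; case: unliftP => [k' ->|->]; case: unliftP => [l' ->|->] //.
  - by move=> /fi ->.
  - by move=> E; case: noti; exists k'.
  - by move=> E; case: noti; exists l'.
by move=> k; case: unliftP.
Qed.

(** The bound on the length comes from shortening a path of tiles near x to one
without repetition. *)
Lemma tile_chain T : exists M : nat, forall i j x y,
  tile P i x -> tile P j y -> chd x y <= T ->
  exists (n : nat) (h : nat -> I), [/\ (n <= M)%N, h 0%N = i, h n = j &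
    forall k, (k < n)%N -> exists2 z, tile P (h k) z & tile P (h k.+1) z].
Proof.
have [M hM] := tiles_near_finite T; exists M => i j x y xi yj xyT.
have hx := tile_H2 xi; have hy := tile_H2 yj.
have [m [f [mM fP]]] := hM x hx.
have [i0 iE] : exists k, i = f k.
  apply: fP; exists x => //; apply: le_trans xyT; rewrite chdxx //.
  exact: chd_ge1.
have [j0 jE] : exists k, j = f k by apply: fP; exists y.
pose A (k : 'I_m) := [set t : R | 0 <= t <= 1 /\ exists a : 'I_p.+3 -> R,
    (forall l, 0 <= a l) /\ (1 - t) *: x + t *: y = \sum_l a l *: P (f k) l].
have A_tile k t : 0 <= t <= 1 -> forall q z, 0 < q -> H2 z ->
    (1 - t) *: x + t *: y = q *: z -> A k t <-> tile P (f k) z.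
  move=> t01 q z q0 hz zE; split=> [[_ [a [a0 aE]]]|[_ [a [a0 aE]]]].
    split=> //; exists (fun l => q^-1 * a l); split=> [l|].
      by rewrite mulr_ge0 // invr_ge0 ltW.
    transitivity (q^-1 *: (q *: z)).
      by rewrite scalerA mulVf ?scale1r ?gt_eqF.
    by rewrite -zE aE scaler_sumr; apply: eq_bigr => l _; rewrite scalerA.
  split=> //; exists (fun l => q * a l); split=> [l|].
    by rewrite mulr_ge0 // ltW.
  by rewrite zE aE scaler_sumr; apply: eq_bigr => l _; rewrite scalerA.
(* Membership of the chord point in the cone over a tile is a closed condition
   on t and is equivalent to membership of its projection in the tile. *)
have conn : connect (fun a b => `[< exists t, A a t /\ A b t >]) i0 j0.
  apply: segment_cover_connect.
  - by move=> k; apply: cone_line_closed => // l; exact: tile_vertex_H2.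
  - move=> t; rewrite /= in_itv /= => t01.
    have [q [z [q0 hz xz zE]]] := segment_point hx hy t01.
    have [l zl] := tile_exists hz.
    have [k lE] : exists k, l = f k.
      by apply: fP; exists z => //; apply: le_trans xz xyT.
    by exists k => //; apply/(A_tile k t t01 q z q0 hz zE); rewrite -lE.
  - apply/(A_tile i0 0 _ 1 x) => //; rewrite ?lexx ?ler01 // -?iE //.
    by rewrite subr0 scale0r addr0.
  - apply/(A_tile j0 1 _ 1 y) => //; rewrite ?lexx ?ler01 // -?jE //.
    by rewrite subrr scale0r add0r.
case/connectP: conn => s0 path0 last0.
case: (shortenP path0) last0 => s path_s uniq_s _ last_s.
have size_s : (size s < m)%N.
  by have := card_uniqP uniq_s => /= <-; rewrite -[leqRHS]card_ord max_card.
exists (size s), (fun k => f (nth i0 (i0 :: s) k)); split.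
- by rewrite (leq_trans (ltnW size_s)).
- by rewrite iE.
- by rewrite jE last_s (last_nth i0).
move=> k ks; have /asboolP [t [At At']] := pathP i0 path_s k ks.
have t01 : 0 <= t <= 1 by case: At.
have [q [z [q0 hz _ zE]]] := segment_point hx hy t01.
by exists z; apply/(A_tile _ t t01 q z q0 hz zE).
Qed.

(* graph *)
Definition corner i k : tiling_graph P :=
  exist (tiling_vertex P) (P i k) (ex_intro _ i (ex_intro _ k erefl)).

Lemma corner_surj (x : tiling_graph P) : exists i k, x = corner i k.
Proof.
by case: x => x [i [k xE]]; exists i, k; apply: eq_exist.
Qed.

Lemma dist_in_tile i k l : dist_le (corner i k) (corner i l) (2 * p.+3).
Proof.
exists (l + (p.+3 - k))%N, (fun n => corner i (iter n (@ordS _) k)); split.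
  by rewrite mul2n -addnn leq_add ?leq_subr // ltnW.
have it n : val (iter n (@ordS _) k) = ((k + n) %% p.+3)%N.
  elim: n => [|n IH]; first by rewrite addn0 modn_small.
  by rewrite iterS /= IH -addn1 modnDml addn1 addnS.
split=> //.
  congr corner; apply: val_inj; rewrite it addnCA subnKC; last exact: ltnW.
  by rewrite modnDr modn_small.
move=> n _; split=> /=.
  by case: (P_convex i) => _ + _; apply.
by exists i, (iter n (@ordS _) k); left.
Qed.

Lemma tiling_coarse T : exists N : nat, forall x y : tiling_graph P,
  chd (sval x) (sval y) <= T -> dist_le x y N.
Proof.
have [M hM] := tile_chain T; exists (M.+1 * (2 * p.+3))%N => x y.
have [i [k ->]] := corner_surj x; have [j [l ->]] := corner_surj y.
move=> /= /(hM i j _ _ (vertex_in_tile i k) (vertex_in_tile j l)).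
move=> [n [h [nM h0 hn hz]]].
apply: (@dist_le_weaken _ (n.+1 * (2 * p.+3))).
  by rewrite leq_mul2r ltnS nM orbT.
rewrite -h0 -hn; elim: n l {nM hn} hz => [|n IH] l hz.
  by rewrite mul1n; exact: dist_in_tile.
have [z zn zSn] := hz n (ltnSn n).
have [a [b ab]] := touching_share_vertex zn zSn.
rewrite mulSn addnC.
have cE : corner (h n) a = corner (h n.+1) b by exact: eq_exist.
apply: (@dist_le_trans _ _ (corner (h n) a)).
  by apply: IH => m mn; apply: hz; exact: ltnW.
by rewrite cE; exact: dist_in_tile.
Qed.

Lemma tiling_strong_cop_win (G : sgraph) : sgraph_iso (tiling_graph P) G ->
  strong_cop_win G 1.
Proof.
move=> [f [[g fK gK] fadj]].
have [D [D1 hD]] := tiles_bounded.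
apply: (@coarse_model_strong_cop_win R G (fun x => sval (g x)) D) => //.
- by move=> x; have [i [k ->]] := corner_surj (g x); exact: tile_vertex_H2.
- move=> x y; rewrite -{1}(gK x) -{1}(gK y) => /fadj [_ [i [k]]].
  by case=> -[-> ->]; apply: (hD i); exact: vertex_in_tile.
- move=> z hz; have [i zi] := tile_exists hz; exists (f (corner i ord0)).
  by rewrite fK; apply: (hD i) => //; exact: vertex_in_tile.
move=> T; have [N hN] := tiling_coarse T; exists N => x y /hN.
move=> [l [w [lN [w0 wl wadj]]]]; exists l, (f \o w); split=> //.
split; rewrite /= ?w0 ?wl ?gK // => i il; exact/fadj/wadj.
Qed.

End Tiling.

Theorem corollary2 (R : realType) (G : sgraph)
    (hG : hyperbolic_tiling_graph R G) :
  sCop G = Some 1%N.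
Proof.
have [p [q [I [P [p3 _ _ [P_reg P_congr P_cover P_edge _] iso]]]]] := hG.
have win : strong_cop_win G 1.
  case: p p3 P P_reg P_congr P_cover P_edge iso => [|[|[|p]]] // _ P.
  move=> P_reg P_congr P_cover P_edge; apply: tiling_strong_cop_win => // i.
  by case: (P_reg i).
rewrite /sCop; case: pselect => [ex|[]]; last by exists 1%N; apply/asboolP.
congr Some; case: ex_minnP => m /asboolP [m0 _] mmin.
by apply/eqP; rewrite eqn_leq m0 andbT mmin //; apply/asboolP.
Qed.
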